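(* If $(F,\le,⅋,\lhd,i,+)$ is an MAV-frame, then the poset $(\mathrm{Chu}(F),\sqsubseteq)$ (pairs of $+$-closed lower sets as defined in the context), equipped with $\otimes$, $\lhd$, $I$, $\neg$ as defined there, is an MAV-algebra (with binary meets given by $\&$).
   Context: A pomonoid $(\bullet,e)$ on a poset $(A,\le)$ is a monoid whose operation is monotone in both arguments; commutative if $x\bullet y=y\bullet x$. A $*$-autonomous partial order $(A,\le,\otimes,I,\neg)$: $(\otimes,I)$ a commutative pomonoid, $\neg$ antitone and involutive, with $x\otimes y\le\neg z$ iff $x\le\neg(y\otimes z)$; it satisfies mix if $\neg I=I$. A pomonoid $(\bullet,i)$ is duoidal over a pomonoid $(\lhd,j)$ if $(w\lhd x)\bullet(y\lhd z)\le(w\bullet y)\lhd(x\bullet z)$, $j\bullet j\le j$, $i\le i\lhd i$, $i\le j$. An MAV-algebra $(A,\le,\otimes,\lhd,I,\neg)$: $(A,\le,\otimes,I,\neg)$ is $*$-autonomous with mix; $(\lhd,I)$ is a pomonoid; $\neg(x\lhd y)=\neg x\lhd\neg y$; $(\otimes,I)$ is duoidal over $(\lhd,I)$; $(A,\le)$ has binary meets. An MAV-frame is $(F,\le,⅋,\lhd,i,+)$ with $(F,\le)$ a poset, $(⅋,i)$ a commutative pomonoid, $(\lhd,i)$ a pomonoid, $+$ monotone binary, satisfying $(w\lhd x)⅋(y\lhd z)\le(w⅋y)\lhd(x⅋z)$, $(x+y)⅋z\le(x⅋z)+(y⅋z)$, $(w\lhd x)+(y\lhd z)\le(w+y)\lhd(x+z)$,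 $i+i\le i$. Construction: lower sets are down-closed subsets, $\eta(x)=\{y\mid y\le x\}$. For a lower set $X$, $\alpha(X)=\{x\mid x\le s$ for some finite $+$-combination $s$ (any binary bracketing) of elements of $X\}$. $\mathcal C(F)$ is the set of $+$-closed lower sets ordered by $\subseteq$, with $X\vee Y=\alpha(X\cup Y)$. $K=\eta(i)$, $X\circledast Y=\alpha(\{z\mid z\le x⅋y,x\in X,y\in Y\})$, $X\hat\lhd Y=\{z\mid z\le x\lhd y,x\in X,y\in Y\}$, $X\multimap Y=\{z\mid\forall x\in X,\ z⅋x\in Y\}$. $\mathrm{Chu}(F)$ consists of pairs $(X^+,X^-)\in\mathcal C(F)^2$ with $X^+\circledast X^-\subseteq K$, ordered by $(X^+,X^-)\sqsubseteq(Y^+,Y^-)$ iff $X^+\subseteq Y^+$ and $Y^-\subseteq X^-$; operations $X\otimes Y=(X^+\circledast Y^+,(Y^+\multimap X^-)\cap(X^+\multimap Y^-))$, $I=(K,K)$, $\neg(X^+,X^-)=(X^-,X^+)$, $X\lhd Y=(X^+\hat\lhd Y^+,X^-\hat\lhd Y^-)$, $X\&Y=(X^+\cap Y^+,X^-\vee Y^-)$. *)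

(* Defs.v *)
From Stdlib Require Import Relation_Definitions.
From mathcomp Require Import ssreflect ssrfun ssrbool.
From mathcomp Require Import classical_sets.

Set Implicit Arguments.
Unset Strict Implicit.
Unset Printing Implicit Defensive.

Local Open Scope classical_set_scope.

(* Posets are Prop-valued order relations; equality is Leibniz equality. *)

Record is_pomonoid (A : Type) (le : relation A) (op : A -> A -> A) (e : A) :
    Prop := {
  pomonoid_assoc : associative op;
  pomonoid_left_id : left_id e op;
  pomonoid_right_id : right_id e op;
  pomonoid_mono : forall x x' y y',
    le x x' -> le y y' -> le (op x y) (op x' y') }.

Record is_star_autonomous (A : Type) (le : relation A) (tensor : A -> A -> A)
    (I : A) (neg : A -> A) : Prop := {
  star_poset : order A le;
  star_pomonoid : is_pomonoid le tensor I;
  star_comm : commutative tensor;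
  star_antitone : forall x y, le x y -> le (neg y) (neg x);
  star_involutive : involutive neg;
  star_adjunction : forall x y z,
    le (tensor x y) (neg z) <-> le x (neg (tensor y z)) }.

Definition satisfies_mix (A : Type) (I : A) (neg : A -> A) : Prop := neg I = I.

(* [(bul, i)] is duoidal over [(seq, j)]; both are assumed to be pomonoids. *)
Record is_duoidal (A : Type) (le : relation A) (bul : A -> A -> A) (i : A)
    (seq : A -> A -> A) (j : A) : Prop := {
  duoidal_interchange : forall w x y z,
    le (bul (seq w x) (seq y z)) (seq (bul w y) (bul x z));
  duoidal_bul_unit : le (bul j j) j;
  duoidal_seq_unit : le i (seq i i);
  duoidal_units : le i j }.

Definition is_meet (A : Type) (le : relation A) (x y m : A) : Prop :=
  [/\ le m x, le m y & forall z, le z x -> le z y -> le z m].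

Record is_MAV_algebra (A : Type) (le : relation A) (tensor seq : A -> A -> A)
    (I : A) (neg : A -> A) : Prop := {
  MAV_star_autonomous : is_star_autonomous le tensor I neg;
  MAV_mix : satisfies_mix I neg;
  MAV_seq_pomonoid : is_pomonoid le seq I;
  MAV_seq_selfdual : forall x y, neg (seq x y) = seq (neg x) (neg y);
  MAV_duoidal : is_duoidal le tensor I seq I;
  MAV_meets : forall x y, exists m, is_meet le x y m }.

Record MAV_frame : Type := {
  carrier :> Type;
  fle : relation carrier;
  fpar : carrier -> carrier -> carrier;
  fseq : carrier -> carrier -> carrier;
  funit : carrier;
  fplus : carrier -> carrier -> carrier;
  fle_order : order carrier fle;
  fpar_pomonoid : is_pomonoid fle fpar funit;
  fpar_comm : commutative fpar;
  fseq_pomonoid : is_pomonoid fle fseq funit;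
  fplus_mono : forall x x' y y',
    fle x x' -> fle y y' -> fle (fplus x y) (fplus x' y');
  fpar_fseq : forall w x y z,
    fle (fpar (fseq w x) (fseq y z)) (fseq (fpar w y) (fpar x z));
  fplus_fpar : forall x y z,
    fle (fpar (fplus x y) z) (fplus (fpar x z) (fpar y z));
  fplus_fseq : forall w x y z,
    fle (fplus (fseq w x) (fseq y z)) (fseq (fplus w y) (fplus x z));
  fplus_funit : fle (fplus funit funit) funit }.

Definition lower_set (F : MAV_frame) (X : set F) : Prop :=
  forall x y, fle x y -> X y -> X x.

Definition plus_closed (F : MAV_frame) (X : set F) : Prop :=
  forall x y, X x -> X y -> X (fplus x y).

Definition is_closed (F : MAV_frame) (X : set F) : Prop :=
  lower_set X /\ plus_closed X.

Definition eta (F : MAV_frame) (x : F) : set F := [set y | fle y x].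

(* Non-empty finite combinations; since [fplus] is not assumed associative or
   commutative, every bracketing and ordering is generated. *)
Inductive combination (F : MAV_frame) (X : set F) : F -> Prop :=
| combination_elem x : X x -> combination X x
| combination_plus s t :
    combination X s -> combination X t -> combination X (fplus s t).

Definition alpha (F : MAV_frame) (X : set F) : set F :=
  [set x | exists2 s, combination X s & fle x s].

Definition par_set (F : MAV_frame) (X Y : set F) : set F :=
  alpha [set z | exists x y, [/\ X x, Y y & fle z (fpar x y)]].

Definition seq_set (F : MAV_frame) (X Y : set F) : set F :=
  [set z | exists x y, [/\ X x, Y y & fle z (fseq x y)]].

Definition lolli_set (F : MAV_frame) (X Y : set F) : set F :=
  [set z | forall x, X x -> Y (fpar z x)].

Definition unit_set (F : MAV_frame) : set F := eta (funit F).
Arguments unit_set F : clear implicits.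

Definition join_set (F : MAV_frame) (X Y : set F) : set F := alpha (X `|` Y).

Section FrameFacts.
Context {F : MAV_frame}.
Implicit Types (X Y Z : set F) (x y z : F).

Lemma fle_refl x : fle x x.
Proof. by case: (fle_order F) => r _ _; exact: r. Qed.

Lemma fle_trans x y z : fle x y -> fle y z -> fle x z.
Proof. by case: (fle_order F) => _ t _; exact: t. Qed.

Lemma fpar_mono x x' y y' :
  fle x x' -> fle y y' -> fle (fpar x y) (fpar x' y').
Proof. exact: pomonoid_mono (fpar_pomonoid F) _ _ _ _. Qed.

Lemma fseq_mono x x' y y' :
  fle x x' -> fle y y' -> fle (fseq x y) (fseq x' y').
Proof. exact: pomonoid_mono (fseq_pomonoid F) _ _ _ _. Qed.

Lemma alpha_closed X : is_closed (alpha X).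
Proof.
split=> [x y xy [s Xs ys]|x y [s Xs xs] [t Xt yt]].
  by exists s => //; exact: fle_trans ys.
by exists (fplus s t); [exact: combination_plus | exact: fplus_mono].
Qed.

Lemma alpha_min X Y : is_closed Y -> X `<=` Y -> alpha X `<=` Y.
Proof.
move=> [lY pY] XY x [s Xs]; move/lY; apply.
by elim: Xs => [y /XY//|u v _ Yu _ Yv]; exact: pY.
Qed.

Lemma sub_alpha X : X `<=` alpha X.
Proof.
by move=> x Xx; exists x; [exact: combination_elem | exact: fle_refl].
Qed.

Lemma unit_set_closed : is_closed (unit_set F).
Proof.
split=> [x y xy yi|x y xi yi]; first exact: fle_trans yi.
by apply: fle_trans (fplus_funit F); exact: fplus_mono.
Qed.

Lemma par_set_closed X Y : is_closed (par_set X Y).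
Proof. exact: alpha_closed. Qed.

Lemma join_set_closed X Y : is_closed (join_set X Y).
Proof. exact: alpha_closed. Qed.

Lemma seq_set_closed X Y : is_closed X -> is_closed Y -> is_closed (seq_set X Y).
Proof.
move=> [_ pX] [_ pY]; split=> [x y xy [a [b [Xa Yb yab]]]|].
  by exists a, b; split=> //; exact: fle_trans yab.
move=> x y [a [b [Xa Yb xab]]] [c [d [Xc Yd ycd]]].
exists (fplus a c), (fplus b d); split; [exact: pX|exact: pY|].
by apply: fle_trans (fplus_fseq _ _ _ _); exact: fplus_mono.
Qed.

Lemma lolli_set_closed X Y : is_closed Y -> is_closed (lolli_set X Y).
Proof.
move=> [lY pY]; split=> [x y xy Hy a Xa|x y Hx Hy a Xa].
  by apply: lY (Hy _ Xa); apply: fpar_mono => //; exact: fle_refl.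
by apply: lY (fplus_fpar x y a) _; apply: pY; [exact: Hx | exact: Hy].
Qed.

Lemma setI_closed X Y : is_closed X -> is_closed Y -> is_closed (X `&` Y).
Proof.
move=> [lX pX] [lY pY]; split=> [x y xy [Xy Yy]|x y [Xx Yx] [Xy Yy]].
  by split; [exact: lX Xy | exact: lY Yy].
by split; [exact: pX | exact: pY].
Qed.

Lemma par_set_sub X Y Z : is_closed Z ->
  par_set X Y `<=` Z <-> (forall x y, X x -> Y y -> Z (fpar x y)).
Proof.
move=> cZ; split=> [H x y Xx Yy|H].
  apply: H; apply: sub_alpha; exists x, y; split=> //; exact: fle_refl.
apply: alpha_min => // z [x [y [Xx Yy zxy]]].
by case: cZ => lZ _; apply: lZ zxy _; exact: H.
Qed.

End FrameFacts.

Record closed_set (F : MAV_frame) : Type := ClosedSet {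
  closed_carrier :> set F;
  closed_carrierP : is_closed closed_carrier }.

Record Chu (F : MAV_frame) : Type := MkChu {
  pos : closed_set F;
  neg : closed_set F;
  chu_orth : par_set pos neg `<=` unit_set F }.
Arguments chu_orth {F} c.

Definition chu_le (F : MAV_frame) : relation (Chu F) :=
  fun X Y => pos X `<=` pos Y /\ neg Y `<=` neg X.

Section ChuFacts.
Context {F : MAV_frame}.
Implicit Types X Y : Chu F.

Lemma orthP (A B : set F) : par_set A B `<=` unit_set F <->
  (forall a b, A a -> B b -> unit_set F (fpar a b)).
Proof. exact: par_set_sub unit_set_closed. Qed.

Lemma chu_unit_orth : par_set (unit_set F) (unit_set F) `<=` unit_set F.
Proof.
apply/orthP => x y xi yi; apply: fle_trans (fpar_mono xi yi) _.
by rewrite (pomonoid_left_id (fpar_pomonoid F)); exact: fle_refl.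
Qed.

Lemma chu_neg_orth X : par_set (neg X) (pos X) `<=` unit_set F.
Proof.
apply/orthP => x y Xx Xy; rewrite fpar_comm.
by have /orthP := chu_orth X; apply.
Qed.

Lemma chu_tensor_orth X Y :
  par_set (par_set (pos X) (pos Y))
    (lolli_set (pos Y) (neg X) `&` lolli_set (pos X) (neg Y)) `<=` unit_set F.
Proof.
apply/orthP => w z XYw [zYX _].
suff H : par_set (pos X) (pos Y) `<=` lolli_set [set z] (unit_set F).
  exact: H XYw z erefl.
apply/par_set_sub; first exact: lolli_set_closed unit_set_closed.
move=> x y Xx Yy _ ->.
rewrite -(pomonoid_assoc (fpar_pomonoid F)) [fpar y z]fpar_comm.
by have /orthP := chu_orth X; apply => //; exact: zYX.
Qed.

Lemma chu_seq_orth X Y :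
  par_set (seq_set (pos X) (pos Y)) (seq_set (neg X) (neg Y))
    `<=` unit_set F.
Proof.
apply/orthP => u v [x [y [Xx Yy le1]]] [x' [y' [Xx' Yy' le2]]].
apply: fle_trans (fpar_mono le1 le2) _; apply: fle_trans (fpar_fseq _ _ _ _) _.
have /orthP /(_ _ _ Xx Xx') lx := chu_orth X.
have /orthP /(_ _ _ Yy Yy') ly := chu_orth Y.
apply: fle_trans (fseq_mono lx ly) _.
by rewrite (pomonoid_left_id (fseq_pomonoid F)); exact: fle_refl.
Qed.

Lemma chu_with_orth X Y :
  par_set (pos X `&` pos Y) (join_set (neg X) (neg Y)) `<=` unit_set F.
Proof.
apply/orthP => x y [Xx Yx] XYy.
suff H : join_set (neg X) (neg Y) `<=` lolli_set [set x] (unit_set F).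
  by rewrite fpar_comm; exact: H XYy x erefl.
apply: alpha_min; first exact: lolli_set_closed unit_set_closed.
move=> z XYz _ ->; rewrite fpar_comm.
by case: XYz => ?; [have /orthP := chu_orth X | have /orthP := chu_orth Y];
  apply.
Qed.

Definition chu_unit : Chu F :=
  @MkChu F (ClosedSet unit_set_closed) (ClosedSet unit_set_closed)
    chu_unit_orth.

Definition chu_neg X : Chu F := MkChu (@chu_neg_orth X).

Definition chu_tensor X Y : Chu F :=
  @MkChu F (ClosedSet (par_set_closed (pos X) (pos Y)))
    (ClosedSet
      (setI_closed (lolli_set_closed (pos Y) (closed_carrierP (neg X)))
                   (lolli_set_closed (pos X) (closed_carrierP (neg Y)))))
    (@chu_tensor_orth X Y).

Definition chu_seq X Y : Chu F :=
  @MkChu F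
    (ClosedSet
      (seq_set_closed (closed_carrierP (pos X)) (closed_carrierP (pos Y))))
    (ClosedSet
      (seq_set_closed (closed_carrierP (neg X)) (closed_carrierP (neg Y))))
    (@chu_seq_orth X Y).

Definition chu_with X Y : Chu F :=
  @MkChu F
    (ClosedSet
      (setI_closed (closed_carrierP (pos X)) (closed_carrierP (pos Y))))
    (ClosedSet (join_set_closed (neg X) (neg Y)))
    (@chu_with_orth X Y).

End ChuFacts.

Arguments chu_unit F : clear implicits.

(* Main.v *)
(* The ordering [X (x) Y <= Z] in Chu(F) unfolds to the three conditions
   [X+ par Y+ <= Z+], [Z- par Y+ <= X-] and [Z- par X+ <= Y-] on elements
   ([chu_tensor_le]). These are symmetric in X, Y and the negation of Z, which
   gives commutativity and the star-autonomous adjunction; by commutativity,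
   associativity needs only one inequality. *)
From Stdlib Require Import Relation_Definitions.
From mathcomp Require Import ssreflect ssrfun ssrbool.
From mathcomp Require Import boolp classical_sets.
Require Import Defs.

Set Implicit Arguments.
Unset Strict Implicit.
Unset Printing Implicit Defensive.

Local Open Scope classical_set_scope.

(** * Sequencing and par on sets of frame elements *)

Section SetOperations.
Context {F : MAV_frame}.
Implicit Types (X Y Z : set F) (x y z : F).

Lemma par_set_intro X Y x y : X x -> Y y -> par_set X Y (fpar x y).
Proof. by have [H _] := par_set_sub X Y (par_set_closed X Y); exact: H. Qed.

Lemma seq_set_intro X Y x y : X x -> Y y -> seq_set X Y (fseq x y).
Proof. by move=> Xx Yy; exists x, y; split=> //; exact: fle_refl. Qed.

Lemma seq_setS X X' Y Y' :
  X `<=` X' -> Y `<=` Y' -> seq_set X Y `<=` seq_set X' Y'.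
Proof. by move=> XX' YY' z [x [y [/XX' ? /YY' ? zxy]]]; exists x, y. Qed.

(** No [alpha] occurs in [seq_set], so the law transfers elementwise from [fseq]; monotonicity
    absorbs the inner downward closure. *)
Lemma seq_setA X Y Z :
  seq_set X (seq_set Y Z) = seq_set (seq_set X Y) Z.
Proof.
have A := pomonoid_assoc (fseq_pomonoid F).
apply/seteqP; split=> u.
  move=> [x [v [Xx [y [z [Yy Zz vyz]]] uxv]]].
  exists (fseq x y), z; split=> //; first exact: seq_set_intro.
  by rewrite -A; apply: fle_trans uxv _; apply: fseq_mono => //; exact: fle_refl.
move=> [v [z [[x [y [Xx Yy vxy]]] Zz uvz]]].
exists x, (fseq y z); split=> //; first exact: seq_set_intro.
by rewrite A; apply: fle_trans uvz _; apply: fseq_mono => //; exact: fle_refl.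
Qed.

Lemma seq_unit_set X : lower_set X -> seq_set (unit_set F) X = X.
Proof.
move=> lX; apply/seteqP; split=> [u [i [x [ii Xx uix]]]|x Xx].
  apply: lX Xx; apply: fle_trans uix _.
  rewrite -[X in fle _ X](pomonoid_left_id (fseq_pomonoid F)).
  by apply: fseq_mono => //; exact: fle_refl.
rewrite -[x](pomonoid_left_id (fseq_pomonoid F)).
by apply: seq_set_intro => //; exact: fle_refl.
Qed.

Lemma seq_set_unit X : lower_set X -> seq_set X (unit_set F) = X.
Proof.
move=> lX; apply/seteqP; split=> [u [x [i [Xx ii uxi]]]|x Xx].
  apply: lX Xx; apply: fle_trans uxi _.
  rewrite -[X in fle _ X](pomonoid_right_id (fseq_pomonoid F)).
  by apply: fseq_mono => //; exact: fle_refl.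
rewrite -[x](pomonoid_right_id (fseq_pomonoid F)).
by apply: seq_set_intro => //; exact: fle_refl.
Qed.

Lemma fpar_unit_le x y : fle y (funit F) -> fle (fpar x y) x.
Proof.
move=> yi; rewrite -[X in fle _ X](pomonoid_right_id (fpar_pomonoid F)).
by apply: fpar_mono => //; exact: fle_refl.
Qed.

End SetOperations.

(** * Order and equality of Chu pairs, then the algebra structure *)

Section ChuAlgebra.
Context {F : MAV_frame}.
Implicit Types X Y Z W : Chu F.
Local Notation posc X := (closed_carrier (pos X)).
Local Notation negc X := (closed_carrier (neg X)).

(** The algebra laws are Leibniz equalities, so the closedness proofs stored in the records must be
    identified by proof irrelevance. *)
Lemma closed_set_inj (A B : closed_set F) :
  closed_carrier A = closed_carrier B -> A = B.
Proof.
case: A B => [A cA] [B cB] /= AB; case: _ / AB cB => cB.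
by rewrite (Prop_irrelevance cA cB).
Qed.

Lemma chu_inj X Y :
  closed_carrier (pos X) = pos Y -> closed_carrier (neg X) = neg Y -> X = Y.
Proof.
case: X Y => [p n o] [p' n' o'] /= /closed_set_inj pp' /closed_set_inj nn'.
case: _ / pp' o'; case: _ / nn' => o'.
by rewrite (Prop_irrelevance o o').
Qed.

Lemma chu_le_refl X : chu_le X X.
Proof. by split. Qed.

Lemma chu_le_trans X Y Z : chu_le X Y -> chu_le Y Z -> chu_le X Z.
Proof.
move=> [p n] [p' n']; split; first exact: subset_trans p'.
exact: subset_trans n.
Qed.

Lemma chu_le_antisym X Y : chu_le X Y -> chu_le Y X -> X = Y.
Proof. by move=> [p n] [p' n']; apply: chu_inj; apply/seteqP. Qed.

Lemma chu_le_order : order (Chu F) (@chu_le F).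
Proof.
split; [exact: chu_le_refl | | exact: chu_le_antisym].
by move=> X Y Z; exact: chu_le_trans.
Qed.

Lemma chu_negK : involutive (@chu_neg F).
Proof. by move=> X; exact: chu_inj. Qed.

Lemma chu_neg_le X Y : chu_le X Y -> chu_le (chu_neg Y) (chu_neg X).
Proof. by case. Qed.

Lemma chu_tensor_le X Y Z : chu_le (chu_tensor X Y) Z <->
  [/\ forall x y, posc X x -> posc Y y -> posc Z (fpar x y),
      forall n y, negc Z n -> posc Y y -> negc X (fpar n y)
    & forall n x, negc Z n -> posc X x -> negc Y (fpar n x)].
Proof.
(* As [pos Z] is closed, the [alpha] in the positive part of the tensor can be tested on generators
   alone. *)
have S := par_set_sub (pos X) (pos Y) (closed_carrierP (pos Z)).
split=> [[/S p n]|[/S p nX nY]].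
  split=> // m x Zm; first by have [+ _] := n _ Zm; apply.
  by have [_ +] := n _ Zm; apply.
by split=> // n Zn; split=> x; [exact: nX | exact: nY].
Qed.

Lemma chu_tensor_comm_le X Y : chu_le (chu_tensor X Y) (chu_tensor Y X).
Proof.
apply/chu_tensor_le; split=> [x y Xx Yy|n y [_ +] Yy|n x [+ _] Xx]; last 2 first.
- exact.
- exact.
by rewrite fpar_comm; exact: par_set_intro.
Qed.

Lemma chu_tensorC : commutative (@chu_tensor F).
Proof. by move=> X Y; apply: chu_le_antisym; exact: chu_tensor_comm_le. Qed.

(** On the right, the positive inclusion carries two of the three conditions, one per factor of the
    intersection; the negative inclusion carries the third. *)
Lemma chu_tensor_adj X Y Z :
  chu_le (chu_tensor X Y) (chu_neg Z) <->
  chu_le X (chu_neg (chu_tensor Y Z)).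
Proof.
have C := @fpar_comm F.
split=> [/chu_tensor_le [p nX nY]|[p n]].
  split=> /=.
    by move=> x Xx; split=> y ?; [rewrite C; exact: nY | exact: p].
  apply/par_set_sub; first exact: closed_carrierP.
  by move=> y z Yy Zz; rewrite C; exact: nX.
apply/chu_tensor_le; split=> [x y Xx Yy|z y Zz Yy|z x Zz Xx] /=.
- by have [_ +] := p _ Xx; apply.
- by apply: n; rewrite C; exact: par_set_intro.
- by rewrite C; have [+ _] := p _ Xx; apply.
Qed.

Lemma chu_tensorS X X' Y Y' :
  chu_le X X' -> chu_le Y Y' -> chu_le (chu_tensor X Y) (chu_tensor X' Y').
Proof.
move=> [pX nX] [pY nY]; apply/chu_tensor_le; split=> [x y /pX ? /pY ?|n y|n x].
- exact: par_set_intro.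
- by move=> [+ _] /pY Yy => /(_ _ Yy) /nX.
- by move=> [_ +] /pX Xx => /(_ _ Xx) /nY.
Qed.

Lemma chu_tensor_assoc_le X Y Z :
  chu_le (chu_tensor X (chu_tensor Y Z)) (chu_tensor (chu_tensor X Y) Z).
Proof.
have A := pomonoid_assoc (fpar_pomonoid F); have C := @fpar_comm F.
apply/chu_tensor_le; split=> [x u Xx|n u [nZ _]|n x [nZ nXY] Xx].
- (* An inclusion out of a [par_set] is checked on generators once the target
     is presented as a closed [lolli_set] out of a singleton. *)
  suff H : par_set (pos Y) (pos Z) `<=`
      lolli_set [set x] (par_set (par_set (pos X) (pos Y)) (pos Z)).
    by move=> /H Hu; rewrite C; exact: Hu.
  apply/par_set_sub; first exact/lolli_set_closed/par_set_closed.
  move=> y z Yy Zz _ ->; rewrite C A.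
  by do 2?[apply: par_set_intro => //].
- suff H : par_set (pos Y) (pos Z) `<=` lolli_set [set n] (neg X).
    by move=> /H Hu; rewrite C; exact: Hu.
  apply/par_set_sub; first exact/lolli_set_closed/closed_carrierP.
  move=> y z Yy Zz _ ->; rewrite C [fpar y z]C A.
  by have [+ _] := nZ _ Zz; apply.
(* The negative part of [chu_tensor Y Z] is an intersection: one half regroups [n] with [z] and
   applies [nZ], the other groups [x] with [y] and applies [nXY]. *)
- split=> [z Zz|y Yy].
    rewrite -A [fpar x z]C A.
    by have [_ +] := nZ _ Zz; apply.
  by rewrite -A; apply: nXY; exact: par_set_intro.
Qed.

Lemma chu_tensorA : associative (@chu_tensor F).
Proof.
move=> X Y Z; apply: chu_le_antisym; first exact: chu_tensor_assoc_le.
(* Swapping every tensor turns the converse into the proved inequality for [Z], [Y], [X]. *)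
rewrite [chu_tensor (chu_tensor X Y) Z]chu_tensorC [chu_tensor X Y]chu_tensorC.
rewrite [chu_tensor X _]chu_tensorC [chu_tensor Y Z]chu_tensorC.
exact: chu_tensor_assoc_le.
Qed.

Lemma chu_tensor_unit : right_id (chu_unit F) (@chu_tensor F).
Proof.
move=> X; have C := @fpar_comm F.
have [lP _] := closed_carrierP (pos X); have [lN _] := closed_carrierP (neg X).
apply: chu_le_antisym.
  apply/chu_tensor_le; split=> [x i Xx ii|n i Xn ii|n x Xn Xx].
  - exact: lP (fpar_unit_le x ii) Xx.
  - exact: lN (fpar_unit_le n ii) Xn.
  (* The third condition asks for [fpar n x] in [unit_set F], which is the orthogonality built into
     a Chu pair. *)
  - by have /orthP := @chu_neg_orth F X; apply.
split=> [x Xx|n [+ _]].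
  rewrite -[x](pomonoid_right_id (fpar_pomonoid F)).
  by apply: par_set_intro => //; exact: fle_refl.
move=> /(_ (funit F) (fle_refl _)).
by rewrite (pomonoid_right_id (fpar_pomonoid F)).
Qed.

Lemma chu_tensor_pomonoid :
  is_pomonoid (@chu_le F) (@chu_tensor F) (chu_unit F).
Proof.
split.
- exact: chu_tensorA.
- by move=> X; rewrite chu_tensorC; exact: chu_tensor_unit.
- exact: chu_tensor_unit.
- by move=> X X' Y Y'; exact: chu_tensorS.
Qed.

Lemma chu_star_autonomous :
  is_star_autonomous (@chu_le F) (@chu_tensor F) (chu_unit F) (@chu_neg F).
Proof.
split.
- exact: chu_le_order.
- exact: chu_tensor_pomonoid.
- exact: chu_tensorC.
- by move=> X Y; exact: chu_neg_le.
- exact: chu_negK.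
- by move=> X Y Z; exact: chu_tensor_adj.
Qed.

Lemma chu_seq_pomonoid : is_pomonoid (@chu_le F) (@chu_seq F) (chu_unit F).
Proof.
split.
- by move=> X Y Z; apply: chu_inj; exact: seq_setA.
- move=> X; have [lP _] := closed_carrierP (pos X).
  have [lN _] := closed_carrierP (neg X).
  by apply: chu_inj; exact: seq_unit_set.
- move=> X; have [lP _] := closed_carrierP (pos X).
  have [lN _] := closed_carrierP (neg X).
  by apply: chu_inj; exact: seq_set_unit.
- by move=> X X' Y Y' [? ?] [? ?]; split; exact: seq_setS.
Qed.

Lemma chu_neg_seq X Y :
  chu_neg (chu_seq X Y) = chu_seq (chu_neg X) (chu_neg Y).
Proof. exact: chu_inj. Qed.

(** Sequencing has the same formula on both components, so the frame interchange [fpar_fseq] settles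
    the positive condition and both negative ones. *)
Lemma chu_tensor_seq W X Y Z :
  chu_le (chu_tensor (chu_seq W X) (chu_seq Y Z))
    (chu_seq (chu_tensor W Y) (chu_tensor X Z)).
Proof.
have I (u v a b c d : F) : fle u (fseq a b) -> fle v (fseq c d) ->
    fle (fpar u v) (fseq (fpar a c) (fpar b d)).
  move=> uab vcd; apply: fle_trans (fpar_mono uab vcd) _.
  exact: fpar_fseq.
apply/chu_tensor_le; split=> u v.
- move=> [w [x [Ww Xx uwx]]] [y [z [Yy Zz vyz]]].
  exists (fpar w y), (fpar x z).
  by split; [exact: par_set_intro | exact: par_set_intro | exact: I].
- move=> [a [b [[aW _] [bX _] uab]]] [y [z [Yy Zz vyz]]].
  exists (fpar a y), (fpar b z).
  by split; [exact: aW | exact: bX | exact: I].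
- move=> [a [b [[_ aY] [_ bZ] uab]]] [w [x [Ww Xx vwx]]].
  exists (fpar a w), (fpar b x).
  by split; [exact: aY | exact: bZ | exact: I].
Qed.

(** The two monoids share their unit, so the unit clauses reduce to unit laws and reflexivity. *)
Lemma chu_duoidal :
  is_duoidal (@chu_le F) (@chu_tensor F) (chu_unit F)
    (@chu_seq F) (chu_unit F).
Proof.
split.
- by move=> W X Y Z; exact: chu_tensor_seq.
- by rewrite chu_tensor_unit; exact: chu_le_refl.
- by rewrite (pomonoid_left_id chu_seq_pomonoid); exact: chu_le_refl.
- exact: chu_le_refl.
Qed.

Lemma chu_with_meet X Y : is_meet (@chu_le F) X Y (chu_with X Y).
Proof.
split=> [||Z [pX nX] [pY nY]].
- by split=> [x []//|n Xn]; apply: sub_alpha; left.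
- by split=> [x []//|n Yn]; apply: sub_alpha; right.
- split=> [z Zz|]; first by split; [exact: pX | exact: pY].
  (* The order reverses negative parts, so a meet needs their join: [alpha] of the union is the
     least closed set above both. *)
  by apply: alpha_min; [exact: closed_carrierP | rewrite subUset].
Qed.

End ChuAlgebra.

Theorem theorem3p48 (F : MAV_frame) :
  is_MAV_algebra (@chu_le F) (@chu_tensor F) (@chu_seq F) (chu_unit F)
    (@chu_neg F) /\
  (forall X Y : Chu F, is_meet (@chu_le F) X Y (chu_with X Y)).
Proof.
split; last exact: chu_with_meet.
split.
- exact: chu_star_autonomous.
(* Mix holds because both components of [chu_unit F] are the same set. *)
- exact: chu_inj.
- exact: chu_seq_pomonoid.
- exact: chu_neg_seq.
- exact: chu_duoidal.
- by move=> X Y; exists (chu_with X Y); exact: chu_with_meet.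
Qed.
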